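(* Let $(X,d)$ be any metric space containing a nontrivial geodesic curve, and let $0<\alpha<1$. Then the metric space $(X,d^\alpha)$ is $\mathrm{SRA}(\epsilon)$ full for each $0<\epsilon<\alpha$.
   Context: For $0\le\epsilon\le 1$, a metric space $(Y,\rho)$ satisfies the $\mathrm{SRA}(\epsilon)$ condition if $\rho(x,y)\le\max\{\rho(x,z)+\epsilon\rho(z,y),\ \epsilon\rho(x,z)+\rho(z,y)\}$ for all $x,y,z\in Y$. A metric space $(Y,\rho)$ is $\mathrm{SRA}(\epsilon)$ full ($0\le\epsilon<1$) if there exists an infinite subset $F\subset Y$ such that $F$ with the restricted metric satisfies the $\mathrm{SRA}(\epsilon)$ condition. A nontrivial geodesic curve in $(X,d)$ is the image of an isometric embedding of a compact interval $[0,\ell]$, $\ell>0$, with the Euclidean metric, into $(X,d)$. *)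

(* Defs.v *)
From HB Require Import structures.
From mathcomp Require Import all_boot all_order all_algebra.
From mathcomp Require Import all_classical all_reals all_analysis.

Set Implicit Arguments.
Unset Strict Implicit.
Unset Printing Implicit Defensive.

Import Order.TTheory GRing.Theory Num.Theory.

Local Open Scope classical_set_scope.
Local Open Scope ring_scope.

(* The SRA(e) condition, for the metric of [Y] restricted to [F]; the condition
   for [Y] itself is the case [F = setT]. It is meant for 0 <= e <= 1. *)
Definition SRA (R : realType) (Y : metricType R) (F : set Y) (e : R) : Prop :=
  forall x y z : Y, F x -> F y -> F z ->
    mdist x y <= Num.max (mdist x z + e * mdist z y)
                         (e * mdist x z + mdist z y).

(* Meant for 0 <= e < 1. *)
Definition SRA_full (R : realType) (Y : metricType R) (e : R) : Prop :=
  exists F : set Y, infinite_set F /\ SRA F e.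

(* The values of [gamma] outside [0, l] are irrelevant. *)
Definition nontrivial_geodesic_curve (R : realType) (X : metricType R)
    (C : set X) : Prop :=
  exists (l : R) (gamma : R -> X),
    [/\ 0 < l,
        {in `[0, l] &, forall s t : R, mdist (gamma s) (gamma t) = `|s - t|} &
        C = gamma @` `[0, l]].

(* The carrier of [X], to be equipped with the metric d^a instead of d; the
   proof argument lets the metric structure be inferred from the type. *)
Definition snowflake (R : realType) (X : metricType R) (a : R)
  (a01 : 0 < a < 1) : Type := X.

Lemma powR_subadditive (R : realType) (a x y : R) :
  0 < a < 1 -> 0 <= x -> 0 <= y -> (x + y) `^ a <= x `^ a + y `^ a.
Proof.
move=> /andP[a0 a1] x0 y0.
have [s0|s0] := eqVneq (x + y) 0.
  by rewrite s0 powR0 ?gt_eqF// addr_ge0 ?powR_ge0.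
have sgt0 : 0 < x + y by rewrite lt_neqAle eq_sym s0 addr_ge0.
have key u : 0 <= u -> u <= x + y -> u / (x + y) * (x + y) `^ a <= u `^ a.
  move=> u0 us; have [->|un0] := eqVneq u 0.
    by rewrite !mul0r powR_ge0.
  have ugt0 : 0 < u by rewrite lt_neqAle eq_sym un0.
  have {2}-> : u = u / (x + y) * (x + y) by rewrite divfK.
  rewrite (powRM _ (divr_ge0 u0 (ltW sgt0)) (ltW sgt0)).
  rewrite ler_wpM2r ?powR_ge0//; apply: ger1_powR (ltW a1).
  by rewrite divr_gt0//= ler_pdivrMr// mul1r.
apply: le_trans (lerD (key x x0 _) (key y y0 _)); rewrite ?lerDl ?lerDr//.
by rewrite -mulrDl -mulrDl divff// mul1r.
Qed.

Section snowflake_metric.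
Context (R : realType) (X : metricType R) (a : R) (a01 : 0 < a < 1).

Let dist (x y : snowflake X a01) : R := mdist (x : X) (y : X) `^ a.

Let distxx x : dist x x = 0.
Proof. by rewrite /dist mdistxx powR0// gt_eqF//; case/andP: a01. Qed.

Let dist_positivity x y : dist x y = 0 -> x = y.
Proof. by move/powR_eq0_eq0/mdist_positivity. Qed.

Let dist_sym x y : dist x y = dist y x.
Proof. by rewrite /dist metric_sym. Qed.

Let dist_triangle y x z : dist x z <= dist x y + dist y z.
Proof.
apply: le_trans (powR_subadditive a01 (mdist_ge0 _ _) (mdist_ge0 _ _)).
case/andP: a01 => a0 _.
by apply: (ge0_ler_powR (ltW a0)); rewrite ?nnegrE ?addr_ge0 ?mdist_ge0//
  metric_triangle.
Qed.

HB.instance Definition _ := Choice.copy (snowflake X a01) X.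
HB.instance Definition _ := isMetric.Build R (snowflake X a01)
  distxx dist_positivity dist_sym dist_triangle.

End snowflake_metric.

Lemma mdist_snowflakeE (R : realType) (X : metricType R) (a : R)
    (a01 : 0 < a < 1) (x y : X) :
  mdist (x : snowflake X a01) (y : snowflake X a01) = mdist x y `^ a.
Proof. by []. Qed.

(* Main.v *)
(** Let [p_n = gamma (l q^n)]. For positions [a < b < c] among the [l q^n], the
    ratio [r = (b - a) / (c - b)] is at most [q / (1 - q)], so for [q] small
    [r <= eps r^alpha], whence
    [(1 + r)^alpha <= 1 + r <= 1 + eps r^alpha], which is SRA for the pair
    [(a, c)] seen from [b] after scaling by [(c - b)^alpha]. For any other
    choice of the intermediate point SRA is mere monotonicity. *)
Require Import Defs.
From mathcomp Require Import all_boot all_order all_algebra.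
From mathcomp Require Import all_classical all_reals all_analysis.
From mathcomp Require Import lra.

Import Order.TTheory GRing.Theory Num.Theory.

Local Open Scope ring_scope.

(** Scaling by [v ^ alpha] reduces to [t = u / v <= r]: there [(t + 1) ^ alpha <= t + 1], and [t = t
    ^ (1 - alpha) * t ^ alpha <= eps * t ^ alpha]. *)
Lemma powR_addr_le (R : realType) (alpha eps r u v : R) :
  0 < alpha < 1 -> 0 <= r -> r `^ (1 - alpha) <= eps ->
  0 <= u -> 0 < v -> u <= r * v ->
  (u + v) `^ alpha <= eps * u `^ alpha + v `^ alpha.
Proof.
move=> /andP[a0 a1] r0 r_eps u0 v0 uv.
have [t [t0 tr ->]] : exists t, [/\ 0 <= t, t <= r & u = t * v].
  exists (u / v); split; first by rewrite divr_ge0 // ltW.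
    by rewrite ler_pdivrMr.
  by rewrite divfK // gt_eqF.
rewrite -[X in _ + X]mul1r -mulrDl !powRM ?addr_ge0 ?(ltW v0) //.
rewrite mulrA -[X in _ <= _ + X]mul1r -mulrDl ler_wpM2r ?powR_ge0 //.
apply: (@le_trans _ _ (t + 1)).
  rewrite -[leRHS]powRr1 ?addr_ge0 //.
  by apply: ler_powR (ltW a1); rewrite lerDr.
rewrite lerD2r -[leLHS]powRr1 // -[X in t `^ X](subrK alpha).
(* Valid even at [t = 0], since the exponents sum to 1 rather than 0. *)
rewrite powRD; last by rewrite subrK oner_eq0.
rewrite ler_wpM2r ?powR_ge0 // (le_trans _ r_eps) //.
by rewrite ge0_ler_powR ?nnegrE // subr_ge0 ltW.
Qed.

Lemma lacunary_SRA (R : realType) (alpha eps q : R) (A : set R) :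
  0 < alpha < 1 -> 0 <= eps -> 0 <= q < 1 ->
  (q / (1 - q)) `^ (1 - alpha) <= eps ->
  (forall s, A s -> 0 <= s) ->
  (forall s t, A s -> A t -> s < t -> s <= q * t) ->
  forall x y z : R, A x -> A y -> A z ->
  `|x - y| `^ alpha <= Num.max (`|x - z| `^ alpha + eps * `|z - y| `^ alpha)
                               (eps * `|x - z| `^ alpha + `|z - y| `^ alpha).
Proof.
move=> alpha01 eps0 /andP[q0 q1] q_eps A0 Aq.
have a0 : 0 <= alpha by case/andP: alpha01 => /ltW.
have q1' : 0 < 1 - q by rewrite subr_gt0.
have mono u v : `|u| <= `|v| -> `|u| `^ alpha <= `|v| `^ alpha.
  by move=> uv; rewrite ge0_ler_powR ?nnegrE.
(* Swapping [x] and [y] exchanges the two entries of the maximum. *)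
move=> x y z; wlog xy : x y / x <= y => [hw|] Ax Ay Az.
  have [xy|/ltW yx] := leP x y; first exact: hw xy Ax Ay Az.
  have := hw _ _ yx Ay Ax Az; rewrite (distrC y x) (distrC y z) (distrC z x).
  by rewrite maxC [X in Num.max X _]addrC [X in Num.max _ X]addrC.
rewrite le_max; have [zx|xz] := leP z x.
  apply/orP; right; apply: ler_wpDl; first by rewrite mulr_ge0 ?powR_ge0.
  by apply: mono; rewrite !ler0_norm; lra.
have [yz|zy] := leP y z.
  apply/orP; left; apply: ler_wpDr; first by rewrite mulr_ge0 ?powR_ge0.
  by apply: mono; rewrite !ler0_norm; lra.
apply/orP; right; rewrite !ler0_norm ?subr_le0 ?(ltW xz) ?(ltW zy) // !opprB.
have -> : y - x = (z - x) + (y - z) by lra.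
apply: (@powR_addr_le _ _ _ (q / (1 - q))) => //.
- by rewrite divr_ge0 // ltW.
- by rewrite subr_ge0 ltW.
- by rewrite subr_gt0.
(* Once denominators are cleared, the claim is [z - (1 - q) * x <= q * y], which follows from
   [z <= q * y] and [0 <= x]. *)
rewrite mulrAC ler_pdivlMr //.
have := Aq _ _ Az Ay zy; have := A0 _ Ax; nra.
Qed.

Theorem theorem1p2 (R : realType) (X : metricType R)
    (geodX : exists C : set X, nontrivial_geodesic_curve C)
    (alpha : R) (alpha01 : 0 < alpha < 1)
    (eps : R) (eps_gt0 : 0 < eps) (eps_lt_alpha : eps < alpha) :
  SRA_full (snowflake X alpha01) eps.
Proof.
case: geodX => _ [l [gamma [l0 iso _]]].
have a1 : 0 < 1 - alpha by rewrite subr_gt0; case/andP: alpha01.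
(* [r] solves [r ^ (1 - alpha) = eps], and [q] solves [q / (1 - q) = r]. *)
pose r := eps `^ (1 - alpha)^-1; pose q := r / (1 + r).
have r0 : 0 < r by rewrite powR_gt0.
have r1 : 0 < 1 + r by rewrite addr_gt0.
have q0 : 0 < q by rewrite divr_gt0.
have q1 : q < 1 by rewrite ltr_pdivrMr // mul1r ltrDr.
have qr : q / (1 - q) = r.
  have -> : 1 - q = (1 + r)^-1.
    by rewrite -{1}(divff (lt0r_neq0 r1)) -mulrBl addrK mul1r.
  by rewrite invrK divfK // gt_eqF.
pose s n := l * q ^+ n.
have s_gt0 n : 0 < s n by rewrite mulr_gt0 // exprn_gt0.
have s_in n : s n \in `[0, l].
  rewrite in_itv /= ltW //= ger_pMr //.
  by rewrite exprn_ile1 // ltW.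
have s_le m n : (m <= n)%N -> s n <= s m.
  by move=> mn; rewrite ler_pM2l // ler_wiXn2l // ltW.
(* As [s] is nonincreasing, [s n < s m] forces [m + 1 <= n], and [s (m + 1) = q * s m]. *)
have s_lac m n : s n < s m -> s n <= q * s m.
  move=> nm; have mn : (m < n)%N.
    by rewrite ltnNge; apply/negP => /s_le; rewrite leNgt nm.
  by apply: le_trans (s_le _ _ mn) _; rewrite /s exprS mulrCA.
have s_inj : injective s.
  by move=> m n /(mulfI (lt0r_neq0 l0)) /(ieexprIn q0 (negbT (lt_eqF q1))).
have gs_inj : injective (gamma \o s).
  move=> m n /= mn; apply: s_inj; apply/eqP; rewrite -subr_eq0 -normr_eq0.
  by rewrite -iso // mn mdistxx.
exists (range (gamma \o s)); split.
  (* A finite range would have a finite preimage under the injection, yet that preimage is all of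
     the naturals. *)
  move=> fin; apply: infinite_nat.
  apply: (@sub_finite_set _ _ ((gamma \o s) @^-1` range (gamma \o s))).
    by move=> n _; exists n.
  by apply: finite_preimage fin => m n _ _ /gs_inj.
move=> _ _ _ [i _ <-] [j _ <-] [k _ <-].
rewrite !(mdist_snowflakeE alpha01) /= !iso //.
apply: (@lacunary_SRA _ _ _ q (range s)) => //.
- exact: ltW.
- by rewrite ltW.
- by rewrite qr -powRrM mulVf ?powRr1 ?gt_eqF // ltW.
- by move=> _ [n _ <-]; exact: ltW.
- by move=> _ _ [n _ <-] [m _ <-]; exact: s_lac.
Qed.
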